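(* Let $\Gamma\subseteq\mathbb{R}^d$ be a $d$-dimensional lattice. Let $f^{iso}(m)$ denote the number of coincidence isometries of $\Gamma$ of coincidence index $m$ divided by the order of the point group of $\Gamma$, and let $f(m)$ denote the number of distinct coincidence site lattices of $\Gamma$ of index $m$. If $f^{iso}$ is multiplicative, then $f$ is multiplicative.
   Context: Let $\Gamma\subseteq\mathbb{R}^d$ be a lattice of full rank $d$. A linear isometry $R\in\mathrm{O}(d)$ is a coincidence isometry of $\Gamma$ if $\Gamma(R):=\Gamma\cap R\Gamma$ has finite index in $\Gamma$; then $\Gamma(R)$ is called an (ordinary) coincidence site lattice (CSL) of $\Gamma$, with index $\Sigma(R):=[\Gamma:\Gamma(R)]$. The point group is the finite group $\mathcal{P}=\{R\in \mathrm{O}(d): R\Gamma=\Gamma\}$. For $m\in\mathbb{N}=\{1,2,\dots\}$, $f^{iso}(m)$ is defined by requiring that $|\mathcal{P}|\,f^{iso}(m)$ is the number of coincidence isometries $R$ with $\Sigma(R)=m$, and $f(m)$ is the number of distinct sublattices of the form $\Gamma(R)$ with $R$ a coincidence isometry and $\Sigma(R)=m$. A function $g:\mathbb{N}\to\mathbb{R}$ is called multiplicative if $g(mn)=g(m)g(n)$ whenever $m$ and $n$ are coprime. *)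

(* Defs.v *)
From mathcomp Require Import all_boot all_algebra finmap.
From mathcomp Require Import boolp classical_sets functions cardinality reals.

Set Implicit Arguments.
Unset Strict Implicit.
Unset Printing Implicit Defensive.
Import GRing.Theory.
Local Open Scope ring_scope.
Local Open Scope classical_set_scope.

Definition full_rank_lattice (R : realType) (d : nat) (G : set 'cV[R]_d) : Prop :=
  exists2 B : 'M[R]_d, B \in unitmx &
    G = [set B *m map_mx intr z | z in [set: 'cV[int]_d]].

Definition orthogonal_group (R : realType) (d : nat) : set 'M[R]_d :=
  [set A | A^T *m A = 1%:M].

Definition lattice_image (R : realType) (d : nat)
    (A : 'M[R]_d) (G : set 'cV[R]_d) : set 'cV[R]_d :=
  [set A *m x | x in G].

(* [fset_set A] is empty when A is infinite, so [ncard A] is the number of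
   elements of A only for finite A. *)
Definition ncard (T : choiceType) (A : set T) : nat := #|` fset_set A|%fset.

Definition cosets (V : zmodType) (G H : set V) : set (set V) :=
  [set [set x + h | h in H] | x in G].

Definition finite_index (V : zmodType) (G H : set V) : Prop :=
  finite_set (cosets G H).

Definition subgroup_index (V : zmodType) (G H : set V) : nat := ncard (cosets G H).

Definition csl (R : realType) (d : nat) (G : set 'cV[R]_d) (A : 'M[R]_d) :
    set 'cV[R]_d :=
  G `&` lattice_image A G.

Definition coincidence_isometry (R : realType) (d : nat)
    (G : set 'cV[R]_d) : set 'M[R]_d :=
  [set A | orthogonal_group A /\ finite_index G (csl G A)].

Definition coincidence_index (R : realType) (d : nat) (G : set 'cV[R]_d)
    (A : 'M[R]_d) : nat :=
  subgroup_index G (csl G A).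

Definition point_group (R : realType) (d : nat) (G : set 'cV[R]_d) :
    set 'M[R]_d :=
  [set A | orthogonal_group A /\ lattice_image A G = G].

Definition coincidence_isometries_of_index (R : realType) (d : nat)
    (G : set 'cV[R]_d) (m : nat) : set 'M[R]_d :=
  [set A | coincidence_isometry G A /\ coincidence_index G A = m].

(* For a lattice G every set counted below is finite: G has finitely many
   subgroups of index m, and if csl G A = L then A^-1 sends a basis of L to
   vectors of G of the same lengths, which leaves finitely many such A. *)
Definition f_iso (R : realType) (d : nat) (G : set 'cV[R]_d) (m : nat) : R :=
  (ncard (coincidence_isometries_of_index G m))%:R / (ncard (point_group G))%:R.

Definition f_csl (R : realType) (d : nat) (G : set 'cV[R]_d) (m : nat) : nat :=
  ncard [set csl G A | A in coincidence_isometries_of_index G m].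

Definition multiplicative_arith (R : realType) (g : nat -> R) : Prop :=
  forall m n : nat, (0 < m)%N -> (0 < n)%N -> coprime m n ->
    g (m * n)%N = g m * g n.

(* Main.v *)
Require Import Defs.
From mathcomp Require Import all_boot all_order all_algebra finmap.
From mathcomp Require Import boolp classical_sets functions cardinality reals.
From mathcomp Require Import zify.

(* Write [S A] for the coincidence index.  For coprime [m] and [n], the
   products [A *m C] with [S A = m] and [S C = n] have index [m * n], and two
   factorizations of the same isometry differ by a factor [T] whose index
   divides both [m ^ 2] and [n ^ 2], that is, by [T] in the point group.
   Counting pairs, multiplicativity of [f_iso] says exactly that every isometry
   of index [m * n] is such a product, and also a product in the other order:
   [D = A *m C = C' *m A'].  Comparing indices, [csl D] is the intersection of
   [csl A] and [csl C'].  Hence intersection maps pairs of CSLs of indices [m]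
   and [n] onto the CSLs of index [m * n]; it is injective because a subgroup of
   index [m * n] lies in only one subgroup of index [m] and one of index [n].
   The counting needs [S A = S A^T], obtained from the determinant formula for
   the index of a sublattice, and the finiteness of the sets of isometries. *)

Set Implicit Arguments.
Unset Strict Implicit.
Unset Printing Implicit Defensive.
Import Order.TTheory GRing.Theory Num.Theory.
Local Open Scope ring_scope.
Local Open Scope classical_set_scope.

(** * Counting with [ncard], infinite sets included *)

Lemma ncard_infinite (T : choiceType) (A : set T) : ~ finite_set A -> ncard A = 0%N.
Proof. by move=> Ainf; rewrite /ncard /fset_set; case: pselect. Qed.

Lemma ncard_eq (T U : choiceType) (A : set T) (B : set U) :
  (A #= B)%card -> ncard A = ncard B.
Proof.
move=> AB; have [Afin|Ainf] := pselect (finite_set A).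
  by apply/fcard_eq => //; rewrite -(eq_finite_set AB).
by rewrite !ncard_infinite// -(eq_finite_set AB).
Qed.

Lemma ncard_inj (T U : choiceType) (A : set T) (f : T -> U) :
  (forall x y, A x -> A y -> f x = f y -> x = y) -> ncard (f @` A) = ncard A.
Proof.
move=> finj; apply/ncard_eq/inj_card_eq => x y /set_mem Ax /set_mem Ay.
exact: finj.
Qed.

(* Both images are in bijection with the set of fibers in [A]. *)
Lemma ncard_kernel (T : Type) (U V : choiceType) (A : set T)
    (f : T -> U) (g : T -> V) :
  (forall x y, A x -> A y -> f x = f y <-> g x = g y) ->
  ncard (f @` A) = ncard (g @` A).
Proof.
move=> fg.
have fibers (W : choiceType) (h : T -> W) :
    ncard (h @` A) = ncard [set [set y | A y /\ h y = h x] | x in A].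
  rewrite -(@ncard_inj _ _ (h @` A) (fun w => [set y | A y /\ h y = w])).
    by rewrite image_comp.
  move=> _ _ [x Ax <-] [y Ay <-] xy.
  have : [set z | A z /\ h z = h y] x by rewrite -xy.
  by case.
rewrite (fibers _ f) (fibers _ g); congr ncard; apply: eq_imagel => x Ax.
by apply/seteqP; split=> y [Ay /(fg _ _ Ay Ax)].
Qed.

(** Since infinite sets count as 0, positivity serves as a finiteness test. *)
Lemma ncard_gt0 (T : choiceType) (A : set T) :
  A !=set0 -> (0 < ncard A)%N <-> finite_set A.
Proof.
move=> A0; split=> [|Afin].
  by apply: contraPP => /ncard_infinite->.
rewrite /ncard cardfs_gt0; apply/fset0Pn; case: A0 => x Ax.
by exists x; rewrite in_fset_set// inE.
Qed.

(** No finiteness is assumed: when both factors are nonempty, an infinite factor makes the product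
    infinite, and both sides are 0. *)
Lemma ncard_setX (T U : choiceType) (A : set T) (B : set U) :
  ncard (A `*` B) = (ncard A * ncard B)%N.
Proof.
have ncard0 (V : choiceType) : ncard (@set0 V) = 0%N.
  by rewrite /ncard fset_set0 cardfs0.
have [->|/set0P A0] := eqVneq A set0; first by rewrite set0X !ncard0.
have [->|/set0P B0] := eqVneq B set0; first by rewrite setX0 !ncard0 muln0.
have [Afin|Ainf] := pselect (finite_set A); last first.
  rewrite (ncard_infinite Ainf) ncard_infinite// => /finite_set_fst.
  apply: contra_not Ainf; apply: sub_finite_set => x Ax.
  by case: B0 => y By; exists y.
have [Bfin|Binf] := pselect (finite_set B); last first.
  rewrite (ncard_infinite Binf) muln0 ncard_infinite// => /finite_set_snd.
  apply: contra_not Binf; apply: sub_finite_set => y By.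
  by case: A0 => x Ax; exists x.
rewrite /ncard fset_setX// -(size_allpairs pair).
apply/perm_size; apply: perm_trans (enum_imfset2 _ _) _ => //.
by move=> [? ?] [? ?] _ _ [-> ->].
Qed.

Lemma ncard_subset (T : choiceType) (A B : set T) :
  finite_set B -> A `<=` B -> (ncard A <= ncard B)%N.
Proof.
move=> Bfin AB; have Afin := sub_finite_set AB Bfin.
by apply: fsubset_leq_card; rewrite -fset_set_sub.
Qed.

Lemma subset_ncard_eq (T : choiceType) (A B : set T) :
  finite_set B -> A `<=` B -> (ncard B <= ncard A)%N -> A = B.
Proof.
move=> Bfin AB; have Afin := sub_finite_set AB Bfin.
move=> BA; apply/fset_set_inj => //; apply/eqP.
by rewrite eqEfcard BA andbT -fset_set_sub.
Qed.

Lemma ncard_finset (T : finType) (A : {set T}) : ncard [set x | x \in A] = #|A|.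
Proof.
rewrite cardE; apply/perm_size/uniq_perm; rewrite ?fset_uniq ?enum_uniq// => x.
by rewrite mem_enum in_fset_set ?mem_setE//; exact: finite_finset.
Qed.

(** * Indices of subgroups *)

Definition is_subgroup (V : zmodType) (H : set V) : Prop :=
  H 0 /\ forall x y, H x -> H y -> H (x - y).

Section Subgroups.
Variable V : zmodType.
Implicit Types (A B C G H K L : set V) (x y : V).

Lemma subgroupN H x : is_subgroup H -> H x -> H (- x).
Proof. by case=> H0 HB Hx; rewrite -sub0r; apply: HB. Qed.

Lemma subgroupD H x y : is_subgroup H -> H x -> H y -> H (x + y).
Proof.
move=> Hsub Hx Hy; rewrite -[y]opprK.
by apply: Hsub.2 => //; exact: subgroupN.
Qed.

Lemma subgroupMn H x k : is_subgroup H -> H x -> H (x *+ k).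
Proof.
move=> Hsub Hx; elim: k => [|k IHk]; first by rewrite mulr0n; case: Hsub.
by rewrite mulrS; apply: subgroupD.
Qed.

Lemma subgroupI H K : is_subgroup H -> is_subgroup K -> is_subgroup (H `&` K).
Proof.
move=> [H0 HB] [K0 KB]; split; first by split.
by move=> x y [Hx Kx] [Hy Ky]; split; [exact: HB | exact: KB].
Qed.

Lemma coset_eq H x y : is_subgroup H ->
  [set x + h | h in H] = [set y + h | h in H] <-> H (x - y).
Proof.
move=> Hsub; split=> [xy|Hxy].
  have : [set y + h | h in H] x by rewrite -xy; exists 0; [exact: Hsub.1 | exact: addr0].
  by case=> h Hh <-; rewrite addrC addKr.
apply/seteqP; split=> _ [h Hh <-].
  by exists (x - y + h); [exact: (subgroupD Hsub) | rewrite addrA addrCA subrr addr0].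
exists (h - (x - y)); first exact: Hsub.2.
by rewrite opprB addrCA [x + _]addrCA subrr addr0 addrC.
Qed.

(** Lets an index be computed from any convenient invariant of cosets, such as residues or pairs of
    cosets. *)
Lemma index_kernel (T : choiceType) G H (g : V -> T) : is_subgroup H ->
  (forall x y, G x -> G y -> g x = g y <-> H (x - y)) ->
  subgroup_index G H = ncard (g @` G).
Proof.
move=> Hsub gH; apply: ncard_kernel => x y Gx Gy.
by split=> [/coset_eq/gH->//|/gH-/(_ Gx Gy)/coset_eq->].
Qed.

Lemma index_gt0 G H : is_subgroup G -> (0 < subgroup_index G H)%N <-> finite_index G H.
Proof.
move=> Gsub; apply: ncard_gt0.
by exists [set 0 + h | h in H]; exists 0 => //; case: Gsub.
Qed.

Lemma index_tower G K L : is_subgroup G -> is_subgroup K -> is_subgroup L ->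
  L `<=` K -> K `<=` G ->
  subgroup_index G L = (subgroup_index G K * subgroup_index K L)%N.
Proof.
move=> Gsub Ksub Lsub LK KG.
pose cosetK x := [set x + h | h in K]; pose cosetL x := [set x + h | h in L].
(* [r] picks a representative in [G] of each [K]-coset; 0 is a dummy value on all other sets. *)
have /choice[r rP] : forall C, exists x, forall z, G z -> C = cosetK z ->
    G x /\ cosetK x = cosetK z.
  move=> C; have [[z [Gz ->]]|noz] := pselect (exists z, G z /\ C = cosetK z).
    by exists z => t Gt <-.
  by exists 0 => z Gz Cz; case: noz; exists z.
have {}rP x : G x -> G (r (cosetK x)) /\ cosetK (r (cosetK x)) = cosetK x.
  by move=> Gx; exact: rP.
(* An element is recorded by its [K]-coset and the [L]-coset of its offset from the representative;
   the values fill the product of [G / K] and [K / L]. *)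
pose g x := (cosetK x, cosetL (x - r (cosetK x))).
rewrite (@index_kernel _ G L g) //; last first.
  move=> x y Gx Gy; split=> [[xy]|Lxy].
    by rewrite xy => /(coset_eq _ _ Lsub); rewrite opprB addrA subrK.
  have xy : cosetK x = cosetK y by apply/coset_eq => //; exact: LK.
  by rewrite /g xy; congr pair; apply/coset_eq; rewrite // opprB addrA subrK.
rewrite -ncard_setX; congr ncard; apply/seteqP.
split=> [_ [x Gx <-]|[_ _] /= [[x Gx <-] [k Kk <-]]].
  have [Grx rx] := rP _ Gx; split; first by exists x.
  by exists (x - r (cosetK x)) => //; apply/coset_eq.
have [Grx rx] := rP _ Gx; exists (r (cosetK x) + k).
  by apply: subgroupD => //; exact: KG.
have rk : cosetK (r (cosetK x) + k) = cosetK x.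
  by rewrite -rx; apply/coset_eq; rewrite // rx addrC addKr.
by rewrite /g rk addrC addKr.
Qed.

Lemma index_self G : is_subgroup G -> subgroup_index G G = 1%N.
Proof.
move=> Gsub; rewrite (@index_kernel _ G G (fun=> tt)) //.
  have -> : [set tt | _ in G] = [set tt].
    by apply/seteqP; split=> [_ [_ _ <-]|_ ->] //; exists 0; first exact: Gsub.1.
  by rewrite /ncard fset_set1 cardfs1.
by move=> x y Gx Gy; split=> // _; apply: Gsub.2.
Qed.

Lemma index1_subset G H : is_subgroup G -> is_subgroup H ->
  subgroup_index G H = 1%N -> G `<=` H.
Proof.
move=> Gsub Hsub GH x Gx.
have fin : finite_set (cosets G H) by apply/index_gt0; rewrite ?GH.
have /cardfs1P[C CE] := introT eqP GH.
have coset0 y : G y -> [set y + h | h in H] = C.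
  move=> Gy; apply/eqP; rewrite -in_fset1 -CE in_fset_set//; apply/mem_set.
  by exists y.
rewrite -[x]subr0; apply/coset_eq; rewrite // !coset0//; exact: Gsub.1.
Qed.

Lemma dvdn_index_capl G H K : is_subgroup G -> is_subgroup H -> is_subgroup K ->
  H `<=` G -> K `<=` G -> (subgroup_index K (K `&` H) %| subgroup_index G H)%N.
Proof.
move=> Gsub Hsub Ksub HG KG.
(* [S = K + H]: both [S / H] and [K / (K & H)] are the set of [H]-cosets met
   by [K]. *)
pose S := [set x | exists2 k, K k & H (x - k)].
have Ssub : is_subgroup S.
  split; first by exists 0; rewrite ?subr0; [exact: Ksub.1 | exact: Hsub.1].
  move=> x y [k Kk Hxk] [l Kl Hyl]; exists (k - l); first exact: Ksub.2.
  have -> : x - y - (k - l) = (x - k) - (y - l).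
    by rewrite !opprB [l - k]addrC addrACA [- y + l]addrC.
  exact: Hsub.2.
rewrite (@index_tower G S H)//; first last.
- move=> x [k Kk Hxk]; rewrite -(subrK k x).
  by apply: subgroupD => //; [exact: HG | exact: KG].
- by move=> x Hx; exists 0; rewrite ?subr0 //; exact: Ksub.1.
rewrite (@index_kernel _ K _ (fun x => [set x + h | h in H])); first last.
- move=> x y Kx Ky; rewrite coset_eq//; split=> [Hxy|[]//].
  by split=> //; exact: Ksub.2.
- exact: subgroupI.
rewrite (_ : ncard _ = subgroup_index S H) ?dvdn_mull//.
congr ncard; apply/seteqP; split=> [_ [k Kk <-]|_ [x [k Kk Hxk] <-]].
  by exists k => //; exists k; rewrite ?subrr //; exact: Hsub.1.
by exists k => //; apply/coset_eq; rewrite // -opprB; exact: subgroupN.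
Qed.

(* As [ncard] of an infinite set is [0], infinite index is recorded as [0] and
   the divisibilities below hold without finiteness assumptions. *)
Definition relative_index A B : nat := subgroup_index A (A `&` B).

Lemma dvdn_relative_index_capl A B C :
  is_subgroup A -> is_subgroup B -> is_subgroup C ->
  (relative_index (A `&` C) B %| relative_index C B)%N.
Proof.
move=> Asub Bsub Csub; rewrite /relative_index.
have -> : A `&` C `&` B = (A `&` C) `&` (C `&` B).
  by rewrite setIA -[A `&` C `&` C]setIA setIid.
by apply: dvdn_index_capl => //; exact: subgroupI.
Qed.

Lemma index_setI3 A B C : is_subgroup A -> is_subgroup B -> is_subgroup C ->
  subgroup_index A (A `&` B `&` C) =
    (relative_index A B * relative_index (A `&` B) C)%N.
Proof.
move=> Asub Bsub Csub; rewrite /relative_index -index_tower//.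
- exact: subgroupI.
- by do 2?apply: subgroupI.
Qed.

(** Pass to the triple intersection: its index in [A] is a multiple of that of the intersection of
    [A] and [C], and it splits as a tower through the intersection of [A] and [B]. *)
Lemma relative_index_trans A B C :
  is_subgroup A -> is_subgroup B -> is_subgroup C ->
  (relative_index A C %| relative_index A B * relative_index B C)%N.
Proof.
move=> Asub Bsub Csub.
apply: (@dvdn_trans (subgroup_index A (A `&` B `&` C))).
  by rewrite setIAC index_setI3// dvdn_mulr.
by rewrite index_setI3// dvdn_mul// dvdn_relative_index_capl.
Qed.

(** Pigeonhole: with [m] the index, two of the [m + 1] cosets of [0, x, ..., m x] agree, so [H]
    contains [k x] for some [0 < k <= m], and [k] divides [m!]. Any common multiple serves, so the
    factorial is good enough. *)
Lemma index_exponent G H x : is_subgroup G -> is_subgroup H ->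
  (0 < subgroup_index G H)%N -> G x -> H (x *+ (subgroup_index G H)`!).
Proof.
move=> Gsub Hsub GH0 Gx; set m := subgroup_index G H.
have /index_gt0-/(_ Gsub) Gfin := GH0.
pose g (k : 'I_m.+1) := [set x *+ k + h | h in H].
have [[i [j [ij gij]]]|ginj] :=
    pselect (exists i j : 'I_m.+1, (i < j)%N /\ g i = g j); last first.
  have : (ncard (g @` setT) <= m)%N.
    apply: ncard_subset => // _ [k _ <-]; exists (x *+ k) => //.
    exact: subgroupMn.
  have -> : setT = [set k | k \in [set: 'I_m.+1]%SET].
    by apply/seteqP; split=> k //= _; rewrite inE.
  rewrite ncard_inj ?ncard_finset ?cardsT ?card_ord ?ltnn// => i j _ _ gij.
  apply: val_inj; apply/eqP; case: ltngtP => // ij; case: ginj.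
    by exists i, j.
  by exists j, i.
move/esym/(coset_eq _ _ Hsub): gij; rewrite -mulrnBr; last exact: ltnW.
have /dvdnP[q ->] : (j - i %| m`!)%N.
  by rewrite dvdn_fact// subn_gt0 ij (leq_trans (leq_subr _ _))// -ltnS.
by rewrite mulnC mulrnA; exact: subgroupMn.
Qed.

End Subgroups.

(** * Sublattices of the integer lattice *)

Lemma subgroup_image (V W : zmodType) (f : V -> W) (H : set V) :
  {morph f : x y / x - y} -> is_subgroup H -> is_subgroup (f @` H).
Proof.
move=> fB Hsub; split.
  by exists 0; [exact: Hsub.1 | rewrite -[in LHS](subrr 0) fB subrr].
by move=> _ _ [x Hx <-] [y Hy <-]; exists (x - y); rewrite ?fB //; exact: Hsub.2.
Qed.

Lemma index_image (V W : zmodType) (f : V -> W) (G H : set V) :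
  injective f -> {morph f : x y / x - y} -> is_subgroup H ->
  subgroup_index (f @` G) (f @` H) = subgroup_index G H.
Proof.
move=> finj fB Hsub; have fHsub := subgroup_image fB Hsub.
rewrite (@index_kernel _ _ G H (fun x => [set f x + h | h in f @` H])) //.
  by rewrite -(image_comp f (fun x => [set x + h | h in f @` H])).
move=> x y _ _; rewrite coset_eq// -fB; split; last by exists (x - y).
by case=> z Hz /finj <-.
Qed.

Lemma absz_det_unitmx (d : nat) (U : 'M[int]_d) : U \in unitmx -> `|\det U|%N = 1%N.
Proof.
move=> Uu; apply/eqP; have /(congr1 (fun A => `|\det A|%N)) := mulmxV Uu.
rewrite det_mulmx abszM det1 => /eqP.
by rewrite muln_eq1 => /andP[].
Qed.

Lemma mulmx_inj_unitmx (K : comUnitRingType) (d p : nat) (A : 'M[K]_d) :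
  A \in unitmx -> injective (mulmx A : 'M_(d, p) -> _).
Proof. by move=> Au; apply: (can_inj (mulKmx Au)). Qed.

Lemma subgroupT (V : zmodType) : is_subgroup [set: V].
Proof. by []. Qed.

Lemma index_diag_mx (d : nat) (r : 'rV[int]_d) : (forall i, r 0 i != 0) ->
  subgroup_index [set: 'cV[int]_d] (range (mulmx (diag_mx r))) =
    (\prod_i `|r 0%R i|)%N.
Proof.
move=> r0.
(* Residues modulo the diagonal entries separate the cosets. The bound is in successor form for
   [inord], and is the exact modulus because [r 0 i != 0]. *)
pose g (z : 'cV[int]_d) : {dffun forall i : 'I_d, 'I_(`|r 0%R i|.-1.+1)} :=
  [ffun i => inord `|(z i 0%R %% r 0%R i)%Z|].
have gE z i : (g z i : nat) = `|(z i 0%R %% r 0%R i)%Z|%N.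
  rewrite ffunE inordK// prednK ?absz_gt0//.
  by rewrite -ltz_nat gez0_abs ?modz_ge0 ?abszE ?ltz_mod.
rewrite (@index_kernel _ _ _ _ g); first last.
- move=> x y _ _; split=> [gxy|[z _ xy]].
    have dvd i : {q | x i 0 - y i 0 = r 0 i * q}.
      exists ((x i 0%R - y i 0%R) %/ r 0%R i)%Z; rewrite mulrC divzK// -eqz_mod_dvd.
      apply/eqP; rewrite -[LHS]gez0_abs ?modz_ge0// -[RHS]gez0_abs ?modz_ge0//.
      by rewrite -!gE gxy.
    exists (\col_i (sval (dvd i))) => //; rewrite mul_diag_mx; apply/colP => i.
    by rewrite !mxE -(svalP (dvd i)).
  apply/ffunP => i; apply: val_inj; rewrite /= !gE; congr absz; apply/eqP.
  move/colP/(_ i): xy; rewrite mul_diag_mx !mxE => xyi.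
  by rewrite eqz_mod_dvd -xyi dvdz_mulr.
- by apply: subgroup_image => // x y; rewrite mulmxBr.
have -> : range g = [set k | k \in setXn (fun i => [set: 'I_(`|r 0%R i|.-1.+1)]%SET)].
  apply/seteqP; split=> f; first by move=> _; apply/setXnP => i; rewrite inE.
  move=> _; exists (\col_i (f i)%:Z) => //; apply/ffunP => i; apply: val_inj.
  rewrite /= gE mxE -modz_abs modz_small//=.
  by rewrite ltz_nat -[ltnRHS](@prednK `|r 0%R i|) ?absz_gt0.
rewrite ncard_finset cardsXn; apply: eq_bigr => i _.
by rewrite cardsT card_ord prednK// absz_gt0.
Qed.

(** By the Smith normal form [M] is diagonal up to unimodular factors, which change neither the
    index nor the absolute value of the determinant. *)
Lemma index_mulmx (d : nat) (M : 'M[int]_d) : \det M != 0 ->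
  subgroup_index [set: 'cV[int]_d] (range (mulmx M)) = `|\det M|%N.
Proof.
have [L Lu [U Uu [s _ ->]]] := int_Smith_normal_form M.
have -> : \matrix_(i, j) (s`_i *+ (i == j :> nat)) = diag_mx (\row_i s`_i) :> 'M[int]_d.
  by apply/matrixP => i j; rewrite !mxE.
set r := \row__ _ => detM; have r0 i : r 0 i != 0.
  move: detM; rewrite !det_mulmx det_diag (bigD1 i)//=.
  by apply: contraNneq => ->; rewrite mul0r mulr0 mul0r.
rewrite !det_mulmx !abszM (absz_det_unitmx Lu) (absz_det_unitmx Uu) mul1n muln1 det_diag.
rewrite (big_morph absz abszM absz1) -index_diag_mx//.
have UT : range (mulmx U : 'cV[int]_d -> _) = setT.
  by apply/seteqP; split=> // x _; exists (invmx U *m x); rewrite ?mulKVmx.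
have LT : range (mulmx L : 'cV[int]_d -> _) = setT.
  by apply/seteqP; split=> // x _; exists (invmx L *m x); rewrite ?mulKVmx.
have -> : range (mulmx (L *m diag_mx r *m U) : 'cV[int]_d -> _) =
    mulmx L @` (range (mulmx (diag_mx r))).
  rewrite -[in RHS]UT !image_comp; apply: eq_imagel => x _ /=.
  by rewrite !mulmxA.
rewrite -{1}LT index_image//; first exact: mulmx_inj_unitmx.
  by move=> x y; rewrite mulmxBr.
by apply: subgroup_image => // x y; rewrite mulmxBr.
Qed.

(** * Coincidence indices *)

Section Orthogonal.
Variables (R : realType) (d : nat).
Implicit Types (A C : 'M[R]_d) (G H : set 'cV[R]_d).

Lemma orthogonal_mulKmx A p : orthogonal_group A ->
  cancel (mulmx A) (mulmx A^T : 'M_(d, p) -> _).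
Proof. by move=> AO x; rewrite mulmxA AO mul1mx. Qed.

Lemma orthogonal_mulVKmx A p : orthogonal_group A ->
  cancel (mulmx A^T) (mulmx A : 'M_(d, p) -> _).
Proof. by move=> /mulmx1C AO x; rewrite mulmxA AO mul1mx. Qed.

Lemma orthogonal_group_tr A : orthogonal_group A -> orthogonal_group A^T.
Proof. by rewrite /orthogonal_group /= trmxK => /mulmx1C. Qed.

Lemma orthogonal_group_mul A C :
  orthogonal_group A -> orthogonal_group C -> orthogonal_group (A *m C).
Proof.
rewrite /orthogonal_group /= => AO CO.
by rewrite trmx_mul mulmxA -(mulmxA _ A^T) AO mulmx1.
Qed.

Lemma sqr_det_orthogonal A : orthogonal_group A -> \det A ^+ 2 = 1.
Proof. by move=> AO; rewrite expr2 -{1}det_tr -det_mulmx AO det1. Qed.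

(** The columns of [A] are unit vectors. *)
Lemma orthogonal_entry_le1 A i j : orthogonal_group A -> `|A i j| <= 1.
Proof.
move=> /matrixP/(_ j j) AO; rewrite -(@expr_le1 _ 2)// real_normK ?num_real//.
move: AO; rewrite !mxE eqxx mulr1n => <-; rewrite (bigD1 i)//= mxE -expr2 lerDl.
by apply: sumr_ge0 => k _; rewrite mxE -expr2 sqr_ge0.
Qed.

Lemma lattice_image_mul A C G :
  lattice_image (A *m C) G = lattice_image A (lattice_image C G).
Proof.
by rewrite /lattice_image image_comp; apply: eq_imagel => x _ /=; rewrite mulmxA.
Qed.

Lemma lattice_image1 G : lattice_image 1%:M G = G.
Proof.
apply/seteqP; split=> x; first by case=> y Gy <-; rewrite mul1mx.
by exists x; rewrite ?mul1mx.
Qed.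

Lemma subgroup_lattice_image A G : is_subgroup G -> is_subgroup (lattice_image A G).
Proof. by apply: subgroup_image => x y; rewrite mulmxBr. Qed.

Lemma index_lattice_image A G H : orthogonal_group A -> is_subgroup H ->
  subgroup_index (lattice_image A G) (lattice_image A H) = subgroup_index G H.
Proof.
move=> AO; apply: index_image; first exact: can_inj (orthogonal_mulKmx AO).
by move=> x y; rewrite mulmxBr.
Qed.

Lemma relative_index_lattice_image A G H :
  orthogonal_group A -> is_subgroup G -> is_subgroup H ->
  relative_index (lattice_image A G) (lattice_image A H) = relative_index G H.
Proof.
move=> AO Gsub Hsub; rewrite /relative_index -[RHS](@index_lattice_image A)//.
  congr subgroup_index; apply/seteqP.
  split=> [_ [[x Gx <-] [y Hy]]|_ [x [Gx Hx] <-]].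
    move=> /(can_inj (orthogonal_mulKmx AO)) yx; rewrite yx in Hy.
    by exists x.
  by split; exists x.
exact: subgroupI.
Qed.

End Orthogonal.

(** * Inverse isometries, and finiteness of the isometries of given index *)

Section Lattice.
Variables (R : realType) (d : nat) (G : set 'cV[R]_d).
Hypothesis latG : full_rank_lattice G.
Implicit Types (A C : 'M[R]_d).

Lemma lattice_subgroup : is_subgroup G.
Proof.
case: latG => B _ ->; apply: (@subgroup_image _ _ (fun z => B *m map_mx intr z)).
  by move=> x y; rewrite map_mxB mulmxBr.
exact: subgroupT.
Qed.

(** The columns of [M] are the coordinates of the images of the basis vectors. *)
Lemma lattice_endomorphism B C :
  G = [set B *m map_mx intr z | z in [set: 'cV[int]_d]] ->
  (forall x, G x -> G (C *m x)) ->
  exists M : 'M[int]_d, C *m B = B *m map_mx intr M.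
Proof.
move=> GE CG.
have /choice[z zE] : forall j, exists z : 'cV[int]_d,
    col j (C *m B) = B *m map_mx intr z.
  move=> j; have : G (C *m col j B).
    apply: CG; rewrite GE; exists (delta_mx j 0) => //.
    by rewrite map_delta_mx -colE.
  by rewrite GE => -[z _ zE]; exists z; rewrite colE -mulmxA -colE zE.
exists (\matrix_(i, j) z j i 0).
apply/matrixP => i j; have /colP/(_ i) := zE j.
by rewrite mxE => ->; rewrite !mxE; apply: eq_bigr => k _; rewrite !mxE.
Qed.

(** In lattice coordinates [N A] is an integer matrix with the same determinant, [N ^ d] up to sign;
    comparing squares disposes of the sign. *)
Lemma index_scaled_isometry A (N : nat) : orthogonal_group A -> (0 < N)%N ->
  (forall x, G x -> G (N%:R *: A *m x)) ->
  subgroup_index G (lattice_image (N%:R *: A) G) = (N ^ d)%N.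
Proof.
move=> AO N0 NAG; have [B Bu GE] := latG.
have [M ME] := lattice_endomorphism GE NAG.
pose iota (z : 'cV[int]_d) := B *m map_mx intr z.
have iotaB : {morph iota : x y / x - y} by move=> x y; rewrite /iota map_mxB mulmxBr.
have iota_inj : injective iota.
  move=> x y /(mulmx_inj_unitmx Bu) xy; apply/colP => i.
  by move/colP/(_ i): xy; rewrite !mxE => /intr_inj.
have -> : lattice_image (N%:R *: A) G = iota @` range (mulmx M).
  rewrite /lattice_image GE !image_comp; apply: eq_imagel => z _ /=.
  by rewrite /iota mulmxA ME map_mxM mulmxA.
have detM : (\det M) ^+ 2 = ((N ^ d) ^ 2)%:Z.
  apply: (@intr_inj R); rewrite rmorphXn /= -det_map_mx.
  have /(congr1 determinant) := ME; rewrite !det_mulmx detZ mulrC.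
  move=> /(mulfI _)<-; last by rewrite -unitfE -unitmxE.
  by rewrite exprMn sqr_det_orthogonal// mulr1 -!natrX pmulrn.
have detM' : `|\det M|%N = (N ^ d)%N.
  move/(congr1 absz): detM; rewrite abszX => /eqP.
  by rewrite /= eqn_exp2r// => /eqP.
have Nd0 : (0 < N ^ d)%N by rewrite expn_gt0 N0.
rewrite GE -/iota index_image//; last first.
  by apply: subgroup_image => // x y; rewrite mulmxBr.
by rewrite index_mulmx// -absz_gt0 detM'.
Qed.

(* With [N] such that [N G] lies in [X := G & A G], both [G] and [A G] contain
   [N G] with index [N ^ d], hence contain [X] with the same index. *)
Lemma coincidence_index_tr A : orthogonal_group A ->
  (0 < coincidence_index G A)%N -> coincidence_index G A^T = coincidence_index G A.
Proof.
move=> AO S0; have Gsub := lattice_subgroup.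
have AGsub := subgroup_lattice_image A Gsub.
set N := ((coincidence_index G A)`!)%N; have N0 : (0 < N)%N by exact: fact_gt0.
have Nsc C x : N%:R *: C *m x = (C *m x) *+ N by rewrite -scalemxAl scaler_nat.
have NG x : G x -> lattice_image A G (x *+ N).
  by move=> Gx; case: (index_exponent Gsub (subgroupI Gsub AGsub) S0 Gx).
pose X := G `&` lattice_image A G; have Xsub : is_subgroup X by exact: subgroupI.
have XG : X `<=` G by exact: subIsetl.
have XAG : X `<=` lattice_image A G by exact: subIsetr.
pose Y := lattice_image (N%:R *: 1%:M) G.
have Ysub : is_subgroup Y by exact: subgroup_lattice_image.
have YX : Y `<=` X.
  move=> _ [x Gx <-]; rewrite Nsc mul1mx; split; last exact: NG.
  exact: subgroupMn.
have GY : subgroup_index G Y = (N ^ d)%N.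
  rewrite index_scaled_isometry//; first by rewrite /orthogonal_group /= trmx1 mulmx1.
  by move=> x Gx; rewrite Nsc mul1mx; exact: subgroupMn.
have AGY : subgroup_index (lattice_image A G) Y = (N ^ d)%N.
  (* Applying [A^T] turns the index of [N G] in [A G] into that of [N A^T G] in [G]. *)
  have -> : Y = lattice_image A (lattice_image (N%:R *: A^T) G).
    by rewrite -lattice_image_mul -scalemxAr (mulmx1C AO).
  rewrite index_lattice_image//; last exact: subgroup_lattice_image.
  rewrite index_scaled_isometry//; first exact: orthogonal_group_tr.
  move=> x /NG[y Gy yx].
  by rewrite -scalemxAl scalemxAr scaler_nat -yx orthogonal_mulKmx.
have -> : coincidence_index G A^T = relative_index (lattice_image A G) G.
  rewrite -[in RHS](@relative_index_lattice_image _ _ A^T)//;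
    last exact: orthogonal_group_tr.
  by rewrite -lattice_image_mul AO lattice_image1.
have XY0 : (0 < subgroup_index X Y)%N.
  have : (0 < N ^ d)%N by rewrite expn_gt0 N0.
  by rewrite -GY (@index_tower _ G X Y)// muln_gt0 => /andP[].
apply/eqP; rewrite -(eqn_pmul2r XY0) /relative_index setIC -/X.
by rewrite -!index_tower//  GY AGY.
Qed.

Lemma finite_bounded_int_matrix (K : nat) :
  finite_set [set M : 'M[int]_d | forall i j, (`|M i j| <= K)%N].
Proof.
pose shift (k : 'I_(K + K).+1) := k%:Z - K%:Z.
apply: (@sub_finite_set _ _ (range (map_mx shift : 'M_d -> 'M_d))); last first.
  exact/finite_image/finite_finset.
move=> M MK; exists (\matrix_(i, j) inord `|M i j + K%:Z|) => //.
apply/matrixP => i j; rewrite !mxE /shift; have := MK i j.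
move: (M i j) => a aK; rewrite inordK; lia.
Qed.

Lemma finite_coincidence_isometries (m : nat) : (0 < m)%N ->
  finite_set (coincidence_isometries_of_index G m).
Proof.
move=> m0; have [B Bu GE] := latG; have Gsub := lattice_subgroup.
(* In the basis [B], [m! A^T] is an integer matrix with bounded entries. *)
set N := (m`!)%N; have N0 : N%:R != 0 :> R by rewrite pnatr_eq0 -lt0n fact_gt0.
(* [c i j] bounds entry [(i, j)] of [invmx B *m (N A^T) *m B], as the entries of [A^T] are at most 1
   in absolute value; [g] recovers [A] from that matrix. *)
pose c i j := N%:R * \sum_k (\sum_l `|invmx B i l|) * `|B k j|.
pose K := (\max_(p : 'I_d * 'I_d) Num.bound (c p.1 p.2))%N.
pose g (M : 'M[int]_d) := (N%:R^-1 *: (B *m map_mx intr M *m invmx B))^T.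
apply: (sub_finite_set _ (finite_image g (finite_bounded_int_matrix K))).
move=> A [[AO _] Sm].
have NAG x : G x -> G (N%:R *: A^T *m x).
  move=> Gx; have S0 : (0 < subgroup_index G (csl G A))%N.
    by rewrite -/(coincidence_index G A) Sm.
  have cslsub := subgroupI Gsub (subgroup_lattice_image A Gsub).
  have [] := index_exponent Gsub cslsub S0 Gx.
  rewrite -/(coincidence_index G A) Sm => _ [y Gy yx].
  by rewrite -scalemxAl scalemxAr scaler_nat -yx orthogonal_mulKmx.
have [M ME] := lattice_endomorphism GE NAG.
exists M; last first.
  by rewrite /g -ME mulmxK// scalerA mulVf// scale1r trmxK.
move=> i j; rewrite -(ler_nat R) natr_absz intr_norm.
have -> : (M i j)%:~R = (invmx B *m (N%:R *: A^T *m B)) i j :> R.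
  by rewrite ME mulKmx// mxE.
apply: (@le_trans _ _ (c i j)).
  rewrite -scalemxAl -scalemxAr mulmxA mxE normrM ger0_norm// ler_wpM2l// mxE.
  apply: (le_trans (ler_norm_sum _ _ _)); apply: ler_sum => k _.
  rewrite normrM ler_wpM2r// mxE; apply: (le_trans (ler_norm_sum _ _ _)).
  by apply: ler_sum => l _; rewrite normrM ler_piMr// mxE orthogonal_entry_le1.
apply: (le_trans (ltW (archi_boundP _))).
  by rewrite mulr_ge0// sumr_ge0// => k _; rewrite mulr_ge0// sumr_ge0.
by rewrite ler_nat; apply: (leq_bigmax (i, j)).
Qed.

End Lattice.

(** * Coprime indices *)

Section CoprimeIndices.
Variables (V : zmodType) (G : set V).
Hypothesis Gsub : is_subgroup G.
Implicit Types (H K L : set V) (m n : nat).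

(** The index of the intersection of [H] and [K] is divisible by [m] and [n], hence by [m * n], and
    divides the index of [L]; so [L] has index 1 in the intersection. *)
Lemma index_setI_coprime m n H K L : coprime m n -> (0 < m)%N -> (0 < n)%N ->
  is_subgroup H -> is_subgroup K -> is_subgroup L ->
  H `<=` G -> K `<=` G -> L `<=` H -> L `<=` K ->
  subgroup_index G H = m -> subgroup_index G K = n ->
  subgroup_index G L = (m * n)%N -> L = H `&` K.
Proof.
move=> mn m0 n0 Hsub Ksub Lsub HG KG LH LK GH GK GL.
have HKsub : is_subgroup (H `&` K) by exact: subgroupI.
have LHK : L `<=` H `&` K by move=> x Lx; split; [exact: LH | exact: LK].
have HKG : H `&` K `<=` G by move=> x [/HG].
apply/seteqP; split=> //; apply: index1_subset => //.
have mnHK : (m * n %| subgroup_index G (H `&` K))%N.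
  rewrite Gauss_dvd// -{1}GH -{1}GK.
  rewrite {1}(@index_tower _ G H (H `&` K))// dvdn_mulr//=.
  rewrite (@index_tower _ G K (H `&` K))//.
  by rewrite dvdn_mulr.
have mn0 : (0 < m * n)%N by rewrite muln_gt0 m0.
apply/eqP; rewrite -dvdn1 -(dvdn_pmul2l mn0) muln1 -[X in (_ %| X)%N]GL.
by rewrite (@index_tower _ G (H `&` K) L)// dvdn_mul.
Qed.

(** The index in [H] of its intersection with [K] divides both [[G : K] = m] and [[H : L] = n], so
    it is 1. *)
Lemma index_coprime_subset m n H K L : coprime m n -> (0 < m)%N ->
  is_subgroup H -> is_subgroup K -> is_subgroup L ->
  H `<=` G -> K `<=` G -> L `<=` H -> L `<=` K ->
  subgroup_index G H = m -> subgroup_index G K = m ->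
  subgroup_index G L = (m * n)%N -> H `<=` K.
Proof.
move=> mn m0 Hsub Ksub Lsub HG KG LH LK GH GK GL.
have HKsub : is_subgroup (H `&` K) by exact: subgroupI.
apply: (@subset_trans _ (H `&` K)); last exact: subIsetr.
apply: index1_subset => //; apply/eqP; rewrite -dvdn1.
have /eqP <- : gcdn m n == 1%N by [].
rewrite dvdn_gcd -{1}GK dvdn_index_capl//=.
move: GL; rewrite (@index_tower _ G H)// GH => /eqP; rewrite eqn_pmul2l// => /eqP <-.
rewrite (@index_tower _ H (H `&` K) L)// ?dvdn_mulr//.
by move=> x Lx; split; [exact: LH | exact: LK].
Qed.

Lemma index_coprime_unique m n H K L : coprime m n -> (0 < m)%N ->
  is_subgroup H -> is_subgroup K -> is_subgroup L ->
  H `<=` G -> K `<=` G -> L `<=` H -> L `<=` K ->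
  subgroup_index G H = m -> subgroup_index G K = m ->
  subgroup_index G L = (m * n)%N -> H = K.
Proof.
move=> mn m0 Hsub Ksub Lsub HG KG LH LK GH GK GL.
by apply/seteqP; split; exact: (@index_coprime_subset m n _ _ L).
Qed.

End CoprimeIndices.

(** * Products and factorizations of isometries of coprime indices *)

Section CoincidenceIsometries.
Variables (R : realType) (d : nat) (G : set 'cV[R]_d).
Hypothesis latG : full_rank_lattice G.
Implicit Types (A C D : 'M[R]_d) (m n : nat).

Let Gsub : is_subgroup G := lattice_subgroup latG.
Local Notation I := (coincidence_isometries_of_index G).
Local Notation S := (coincidence_index G).

Lemma subgroup_csl A : is_subgroup (csl G A).
Proof. by apply: subgroupI => //; exact: subgroup_lattice_image. Qed.

(** A positive index already forces finite index, infinite index being recorded as 0. *)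
Lemma coincidence_isometries_of_indexP m A : (0 < m)%N ->
  I m A <-> orthogonal_group A /\ S A = m.
Proof.
move=> m0; split=> [[[]]//|[AO SA]]; split=> //; split=> //.
by apply/index_gt0; rewrite // -/(S A) SA.
Qed.

Lemma coincidence_isometries_of_index_tr m A : (0 < m)%N -> I m A -> I m A^T.
Proof.
move=> m0 /(coincidence_isometries_of_indexP _ m0)[AO SA].
apply/coincidence_isometries_of_indexP => //; split; first exact: orthogonal_group_tr.
by rewrite coincidence_index_tr ?SA.
Qed.

Lemma coincidence_index_mul A C : orthogonal_group A ->
  relative_index (lattice_image A G) (lattice_image (A *m C) G) = S C.
Proof.
move=> AO; rewrite lattice_image_mul relative_index_lattice_image//.
exact: subgroup_lattice_image.
Qed.

(** Go from [G] to [A C G] through [A G]; by isometry the second leg has index [S C]. *)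
Lemma dvdn_coincidence_index_mul A C : orthogonal_group A ->
  (S (A *m C) %| S A * S C)%N.
Proof.
move=> AO; rewrite -(coincidence_index_mul C AO).
by apply: relative_index_trans => //; exact: subgroup_lattice_image.
Qed.

Lemma coprime_csl_mul m n A C : (0 < m)%N -> (0 < n)%N -> coprime m n ->
  I m A -> I n C -> I (m * n)%N (A *m C) /\ csl G (A *m C) `<=` csl G A.
Proof.
move=> m0 n0 mn Am Cn; have mn0 : (0 < m * n)%N by rewrite muln_gt0 m0.
have /(coincidence_isometries_of_indexP _ m0)[AtO SAt] :=
  coincidence_isometries_of_index_tr m0 Am.
have /(coincidence_isometries_of_indexP _ n0)[CtO SCt] :=
  coincidence_isometries_of_index_tr n0 Cn.
move: Am => /(coincidence_isometries_of_indexP _ m0)[AO SA].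
move: Cn => /(coincidence_isometries_of_indexP _ n0)[CO SC].
have ACO := orthogonal_group_mul AO CO.
have SAC : S (A *m C) = (m * n)%N.
  apply/eqP; rewrite eqn_dvd -{1}SA -{1}SC dvdn_coincidence_index_mul//=.
  (* From [A = (A C) C^T], [m] divides [S (A *m C) * n], and coprimality removes [n]; symmetrically,
     [C = A^T (A C)] handles [n]. *)
  rewrite Gauss_dvd//; apply/andP; split.
    rewrite -(@Gauss_dvdl m _ n)// -{1}SA -SCt.
    have := @dvdn_coincidence_index_mul _ C^T ACO.
    by rewrite -mulmxA (mulmx1C CO) mulmx1.
  rewrite -(@Gauss_dvdr n m _) 1?coprime_sym// -{1}SC -SAt.
  by have := @dvdn_coincidence_index_mul _ (A *m C) AtO; rewrite mulmxA AO mul1mx.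
split; first exact/coincidence_isometries_of_indexP.
pose AG := lattice_image A G; pose ACG := lattice_image (A *m C) G.
have AGsub : is_subgroup AG by exact: subgroup_lattice_image.
have ACGsub : is_subgroup ACG by exact: subgroup_lattice_image.
(* The intersection of [G], [A G] and [A C G] has index dividing [m * n], which is already the index
   of the larger [csl G (A *m C)]. The two coincide, which gives the inclusion. *)
have triple : (subgroup_index G (G `&` AG `&` ACG) %| m * n)%N.
  rewrite index_setI3// dvdn_mul//; first by rewrite -SA.
  rewrite -SC -(coincidence_index_mul C AO); exact: dvdn_relative_index_capl.
have : relative_index (G `&` ACG) AG = 1%N.
  apply/eqP; rewrite -dvdn1 -(@dvdn_pmul2l (m * n))// muln1.
  rewrite -{1}SAC -[S _]/(relative_index G ACG) -index_setI3//.
  by rewrite setIAC.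
move/index1_subset => sub x ACx.
have GACsub := subgroupI Gsub ACGsub.
have [] := sub GACsub (subgroupI GACsub AGsub) x ACx.
by case=> Gx _ AGx; split.
Qed.

(** Index 1 only places [G] inside [A G]; the reverse inclusion comes from [A^T], which also has
    index 1. *)
Lemma point_groupE : point_group G = I 1%N.
Proof.
apply/seteqP; split=> A.
  move=> [AO AG]; apply/coincidence_isometries_of_indexP => //; split=> //.
  by rewrite /coincidence_index /csl AG setIid index_self.
move=> A1; have At1 := coincidence_isometries_of_index_tr (ltn0Sn 0) A1.
have sub C : I 1%N C -> G `<=` lattice_image C G.
  move=> [_ SC]; apply: subset_trans (@subIsetr _ G _).
  by apply: index1_subset => //; exact: subgroup_csl.
have [[AO _] _] := A1; split=> //; apply/seteqP; split; last exact: sub.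
move=> _ [x Gx <-]; have [y Gy <-] := sub _ At1 _ Gx.
by rewrite orthogonal_mulVKmx.
Qed.

Lemma coprime_factor_unique m n A1 A2 C1 C2 : (0 < m)%N -> (0 < n)%N -> coprime m n ->
  I m A1 -> I m A2 -> I n C1 -> I n C2 -> A1 *m C1 = A2 *m C2 ->
  point_group G (A2^T *m A1).
Proof.
move=> m0 n0 mn Am1 Am2 Cn1 Cn2 AC.
have /(coincidence_isometries_of_indexP _ m0)[A2tO SA2t] :=
  coincidence_isometries_of_index_tr m0 Am2.
have /(coincidence_isometries_of_indexP _ n0)[C1tO SC1t] :=
  coincidence_isometries_of_index_tr n0 Cn1.
move: Am1 => /(coincidence_isometries_of_indexP _ m0)[A1O SA1].
move: Cn2 => /(coincidence_isometries_of_indexP _ n0)[C2O SC2].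
have [[C1O _] _] := Cn1; have [[A2O _] _] := Am2.
rewrite point_groupE; apply/coincidence_isometries_of_indexP => //; split.
  exact: orthogonal_group_mul.
apply/eqP; rewrite -dvdn1.
have /eqP <- : gcdn (m * m) (n * n) == 1%N.
  by rewrite -/(coprime _ _) coprimeMl !coprimeMr mn.
rewrite dvdn_gcd; apply/andP; split.
  by rewrite -{1}SA2t -SA1 dvdn_coincidence_index_mul.
(* The same factor written through the [C]s has index dividing [n * n]. *)
have -> : A2^T *m A1 = C2 *m C1^T.
  rewrite -[A1]mulmx1 -(mulmx1C C1O) (mulmxA A1) AC -mulmxA.
  by rewrite orthogonal_mulKmx.
by rewrite -{1}SC2 -SC1t dvdn_coincidence_index_mul.
Qed.

Hypothesis iso_mult : multiplicative_arith (f_iso G).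

Lemma coprime_factorization m n D : (0 < m)%N -> (0 < n)%N -> coprime m n ->
  I (m * n)%N D -> exists A C, [/\ I m A, I n C & D = A *m C].
Proof.
move=> m0 n0 mn; have mn0 : (0 < m * n)%N by rewrite muln_gt0 m0.
(* [J] lies in the finite set [I (m * n)], so it suffices that [J] is at least as large. *)
pose J := [set p.1 *m p.2 | p in I m `*` I n].
suff <- : J = I (m * n)%N by case=> -[A C] /= [Am Cn] <-; exists A, C.
apply: subset_ncard_eq; first exact: finite_coincidence_isometries.
  by move=> _ [[A C] /= [Am Cn] <-]; have [] := coprime_csl_mul m0 n0 mn Am Cn.
have P0 : (0 < ncard (point_group G))%N.
  apply/ncard_gt0.
    exists 1%:M; split; last exact: lattice_image1.
    by rewrite /orthogonal_group /= trmx1 mulmx1.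
  by rewrite point_groupE; exact: finite_coincidence_isometries.
(* Multiplicativity of [f_iso] with the denominators cleared. *)
have count : (ncard (I (m * n)%N) * ncard (point_group G) =
    ncard (I m) * ncard (I n))%N.
  have P0' : (ncard (point_group G))%:R != 0 :> R by rewrite pnatr_eq0 -lt0n.
  have := iso_mult m0 n0 mn; rewrite /f_iso mulf_div => /eqP.
  rewrite eqr_div ?mulf_neq0// mulrA => /eqP/(mulIf P0')/eqP.
  by rewrite -!natrM eqr_nat => /eqP.
rewrite -(leq_pmul2r P0) count -!ncard_setX.
have /choice[s sP] : forall D, exists p, J D -> (I m `*` I n) p /\ p.1 *m p.2 = D.
  move=> E; have [[p Ip <-]|nJ] := pselect (J E); first by exists p.
  by exists (0, 0).
(* [s] fixes one factorization of each product. [h] sends a pair to its product and its deviation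
   from the fixed factorization, a point group element; it is injective, so [J] times the point
   group has at least as many elements as there are pairs. *)
pose h (p : 'M[R]_d * 'M[R]_d) := (p.1 *m p.2, (s (p.1 *m p.2)).1^T *m p.1).
rewrite -(@ncard_inj _ _ (I m `*` I n) h).
  apply: ncard_subset.
    apply: finite_setX; last first.
      by rewrite point_groupE; exact: finite_coincidence_isometries.
    by apply/finite_image/finite_setX; exact: finite_coincidence_isometries.
  move=> _ [[A C] [/= Am Cn] <-]; split => /=; first by exists (A, C).
  have [|[sm sn] sE] := sP (A *m C); first by exists (A, C).
  exact: (coprime_factor_unique m0 n0 mn Am sm Cn sn).
move=> [A1 C1] [A2 C2] [/= Am1 Cn1] [/= Am2 Cn2]; rewrite /h /= => -[AC].
rewrite AC; have [|[[[sO _] _] _] _] := sP (A2 *m C2); first by exists (A2, C2).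
move/(can_inj (orthogonal_mulKmx (orthogonal_group_tr sO))) => A12.
have [[A2O _] _] := Am2; move: AC; rewrite A12.
by move/(can_inj (orthogonal_mulKmx A2O)) ->.
Qed.

Lemma coprime_csl_setI m n A C : (0 < m)%N -> (0 < n)%N -> coprime m n ->
  I m A -> I n C ->
  exists2 D, I (m * n)%N D & csl G D = csl G A `&` csl G C.
Proof.
move=> m0 n0 mn Am Cn; have nm : coprime n m by rewrite coprime_sym.
have Atm := coincidence_isometries_of_index_tr m0 Am.
have [AC _] := coprime_csl_mul m0 n0 mn Atm Cn; rewrite mulnC in AC.
have [C' [A' [Cn' Am' ACE]]] := coprime_factorization n0 m0 nm AC.
have Atm' := coincidence_isometries_of_index_tr m0 Am'.
have [[AO _] _] := Am; have [[AO' _] _] := Am'.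
have DE : A *m C' = C *m A'^T.
  rewrite -[C'](mulmx1) -(mulmx1C AO') (mulmxA C') -ACE -(mulmxA A^T).
  by rewrite orthogonal_mulVKmx.
have [Dmn DA] := coprime_csl_mul m0 n0 mn Am Cn'.
have [_ DC] := coprime_csl_mul n0 m0 nm Cn Atm'; rewrite -DE in DC.
exists (A *m C') => //.
apply: (index_setI_coprime Gsub mn m0 n0 _ _ _ _ _ DA DC) => //;
  by [exact: subgroup_csl | exact: subIsetl | exact: Am.2 | exact: Cn.2 | exact: Dmn.2].
Qed.

End CoincidenceIsometries.

(** * Intersection as a bijection between pairs of CSLs and CSLs of the product index *)

Theorem theorem9 (R : realType) (d : nat) (G : set 'cV[R]_d) :
  full_rank_lattice G ->
  multiplicative_arith (f_iso G) ->
  multiplicative_arith (fun m : nat => (f_csl G m)%:R : R).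
Proof.
move=> latG iso_mult m n m0 n0 mn; rewrite -natrM; congr _%:R.
have Gsub := lattice_subgroup latG; have nm : coprime n m by rewrite coprime_sym.
rewrite /f_csl -ncard_setX.
pose cap (p : set 'cV[R]_d * set 'cV[R]_d) := p.1 `&` p.2.
rewrite -[RHS](@ncard_inj _ _ _ cap).
  congr ncard; apply/seteqP; split.
    (* Surjectivity: factoring [D] in both orders places its CSL in one of index [m] and one of
       index [n]. *)
    move=> _ [D Dmn <-]; have := Dmn; rewrite {1}mulnC => Dnm.
    have [A [C [Am Cn DE]]] := coprime_factorization latG iso_mult m0 n0 mn Dmn.
    have [C' [A' [Cn' Am' DE']]] :=
      coprime_factorization latG iso_mult n0 m0 nm Dnm.
    have [_ DA] := coprime_csl_mul latG m0 n0 mn Am Cn; rewrite -DE in DA.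
    have [_ DC] := coprime_csl_mul latG n0 m0 nm Cn' Am'; rewrite -DE' in DC.
    exists (csl G A, csl G C'); first by split; [exists A | exists C'].
    apply/esym/(index_setI_coprime Gsub mn m0 n0 _ _ _ _ _ DA DC) => //;
      by [exact: subgroup_csl | exact: subIsetl | exact: Am.2 | exact: Cn'.2 | exact: Dmn.2].
  move=> _ [[_ _] [/= [A Am <-] [C Cn <-]] <-].
  have [D Dmn DE] := coprime_csl_setI latG iso_mult m0 n0 mn Am Cn.
  by exists D.
move=> [_ _] [_ _] [/= [A Am <-] [C Cn <-]] [/= [A' Am' <-] [C' Cn' <-]].
rewrite /cap /= => capE.
(* Injectivity: the common intersection is a CSL of index [m * n], so it lies in a unique subgroup
   of index [m] and a unique one of index [n]. *)
have [D Dmn DE] := coprime_csl_setI latG iso_mult m0 n0 mn Am Cn.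
have DE' := etrans DE capE.
have [DA DC] : csl G D `<=` csl G A /\ csl G D `<=` csl G C.
  by rewrite DE; split; [exact: subIsetl | exact: subIsetr].
have [DA' DC'] : csl G D `<=` csl G A' /\ csl G D `<=` csl G C'.
  by rewrite DE'; split; [exact: subIsetl | exact: subIsetr].
have nmD : subgroup_index G (csl G D) = (n * m)%N by rewrite mulnC; exact: Dmn.2.
congr pair.
  apply: (index_coprime_unique Gsub mn m0 _ _ _ _ _ DA DA') => //;
    by [exact: subgroup_csl | exact: subIsetl | exact: Am.2 | exact: Am'.2 | exact: Dmn.2].
apply: (index_coprime_unique Gsub nm n0 _ _ _ _ _ DC DC') => //;
  by [exact: subgroup_csl | exact: subIsetl | exact: Cn.2 | exact: Cn'.2].
Qed.
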